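(* For all $c_h,w_h\in V_{h,k_c}$, $$\sum_{T\in\mathcal{T}_h}\int_{\partial T}c_hw_h(\mathbf{U}\cdot\mathbf{n})\,ds-\sum_{T\in\mathcal{T}_h}\int_{\Gamma_-^{\circ}(T)}(c_h^+-c_h^-)w_h^+(\mathbf{U}\cdot\mathbf{n}^+)\,ds-\int_{\Gamma_-}c_h\,\mathbf{U}\cdot\mathbf{n}\,w_h\,ds$$ $$=\sum_{e\in\mathcal{E}_h,\ e\not\subset\Gamma_-}\int_e\{\mathbf{U}c_h\}\cdot[w_h]\,ds+\sum_{e\in\mathcal{E}_h^o}\int_e\frac{|\mathbf{U}\cdot\mathbf{n}|}{2}[c_h]\cdot[w_h]\,ds.$$
   Context: $\Omega\subset\mathbb{R}^d$ ($d=2,3$) is a bounded polygon/polyhedron with a shape-regular triangulation $\mathcal{T}_h$; $\mathcal{E}_h$ is the set of edges (faces), $\mathcal{E}_h^o$ the interior ones; $V_{h,k}=\{v\in L^2(\Omega):v|_T\in\mathbb{P}_k(T)\ \forall T\in\mathcal{T}_h\}$, where $\mathbb{P}_k(T)$ denotes polynomials of degree at most $k$. $\mathbf{U}$ is a velocity field (numerical flux) whose normal component on each edge is single-valued, and $\mathbf{U}\cdot\mathbf{n}_e$ does not change sign on each edge $e\in\mathcal{E}_h$. $\Gamma_-=\{x\in\partial\Omega:\mathbf{U}\cdot\mathbf{n}<0\}$ is the inflow boundary, a union of boundary edges. $\Gamma_-^\circ(T)$ is the part of $\partial T$ consisting of interior edges on which $\mathbf{U}\cdot\mathbf{n}<0$,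 with $\mathbf{n}$ the outward normal of $T$. In integrals over $\partial T$, $c_h$ and $w_h$ are traces from $T$ and $\mathbf{n}$ is the outward normal of $T$. For an interior edge with $\mathbf{U}\cdot\mathbf{n}\neq0$, $T^+$ is the downstream and $T^-$ the upstream element; $v^\pm=\lim_{\epsilon\to0^+}v(x\pm\epsilon\mathbf{U})$ are the downstream/upstream traces, and $\mathbf{n}^\pm$ the outward unit normals of $T^\pm$ (so $T=T^+$ on $\Gamma_-^\circ(T)$). Averages and jumps on interior edges: $\{\boldsymbol\tau\}=\frac12(\boldsymbol\tau^++\boldsymbol\tau^-)$ for vectors and $[\phi]=\phi^+\mathbf{n}^++\phi^-\mathbf{n}^-$ for scalars; on boundary edges $\{\boldsymbol\tau\}=\boldsymbol\tau$ and $[\phi]=\phi\mathbf{n}$. *)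

(* Defs.v *)
From HB Require Import structures.
From mathcomp Require Import all_boot all_order all_algebra.
From mathcomp Require Import all_classical all_reals all_analysis.
From mathcomp Require mpoly.

Set Implicit Arguments.
Unset Strict Implicit.
Unset Printing Implicit Defensive.

Import Order.TTheory GRing.Theory Num.Theory.
Import numFieldNormedType.Exports.

Local Open Scope classical_set_scope.
Local Open Scope ring_scope.

(* The norm that MathComp-Analysis puts on row vectors is the max norm; it    *)
(* is used only through the topology. Lengths are Euclidean.                  *)
Definition dot (R : realType) (d : nat) (u v : 'rV[R]_d) : R :=
  \sum_i u 0 i * v 0 i.

Definition enorm (R : realType) (d : nat) (u : 'rV[R]_d) : R :=
  Num.sqrt (dot u u).

Definition boundary (R : realType) (d : nat) (A : set 'rV[R]_d) :
  set 'rV[R]_d := closure A `\` A°.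

(* A simplicial mesh with numbered vertices. An element is the set of its     *)
(* d + 1 vertex numbers, a face (an edge if d = 2) the set of its d vertex    *)
(* numbers. Well-formedness is [triangulation] below.                         *)
Record mesh (R : realType) (d : nat) := Mesh {
  nvert : nat;
  vert : 'I_nvert -> 'rV[R]_d;
  elements : {set {set 'I_nvert}} }.

(* A cell is any set of vertex numbers. *)
Notation cell M := {set 'I_(nvert M)}.

Section Mesh.
Variables (R : realType) (d : nat) (M : mesh R d).
Implicit Types (T e s : cell M).

Definition hull s : set 'rV[R]_d :=
  [set x | exists a : 'I_(nvert M) -> R, [/\ forall i, i \in s -> 0 <= a i,
    \sum_(i in s) a i = 1 & x = \sum_(i in s) a i *: vert i]].

Definition relint s : set 'rV[R]_d :=
  [set x | exists a : 'I_(nvert M) -> R, [/\ forall i, i \in s -> 0 < a i,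
    \sum_(i in s) a i = 1 & x = \sum_(i in s) a i *: vert i]].

Definition affine_independent s : Prop :=
  forall a : 'I_(nvert M) -> R,
    \sum_(i in s) a i = 0 -> \sum_(i in s) a i *: vert i = 0 ->
    forall i, i \in s -> a i = 0.

Definition facets T : {set cell M} :=
  [set e : cell M | (e \subset T) && (#|e| == d)].

Definition faces : {set cell M} := \bigcup_(T in elements M) facets T.

Definition adjacent e : {set cell M} := [set T in elements M | e \in facets T].

Definition is_outward_normal T e (n : 'rV[R]_d) : Prop :=
  [/\ enorm n = 1,
      forall i j, i \in e -> j \in e -> dot n (vert i - vert j) = 0 &
      forall i j, i \in e -> j \in T :\: e -> dot n (vert j - vert i) < 0].

Definition normal T e : 'rV[R]_d := xget 0 [set n | is_outward_normal T e n].

Definition diameter T : R :=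
  sup [set r | exists x y, [/\ hull T x, hull T y & r = enorm (x - y)]].

Definition inradius T : R :=
  sup [set r | exists c, [set x | enorm (x - c) < r] `<=` hull T].

Definition shape_regular (sigma : R) : Prop :=
  forall T, T \in elements M -> diameter T <= sigma * inradius T.

Variable Omega : set 'rV[R]_d.

Definition boundary_faces : {set cell M} :=
  [set e in faces | `[< hull e `<=` boundary Omega >]].

Definition interior_faces : {set cell M} := faces :\: boundary_faces.

(* Ciarlet's conditions on a triangulation of the closure of Omega by         *)
(* simplices.                                                                 *)
Record triangulation : Prop := {
  vert_inj : injective (@vert R d M);
  element_simplex : forall T, T \in elements M ->
    #|T| = d.+1 /\ affine_independent T;
  elements_cover :
    closure Omega = \bigcup_(T in [set` elements M]) hull T;
  elements_disjoint : forall T1 T2, T1 \in elements M -> T2 \in elements M ->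
    T1 != T2 -> (hull T1)° `&` (hull T2)° = set0;
  faces_match : forall T e, T \in elements M -> e \in facets T ->
    hull e `<=` boundary Omega \/
    exists2 T', T' \in elements M & T' != T /\ e \in facets T' }.

(* Integration with respect to the surface measure ds over relint e, which    *)
(* is e up to a null set. The reference simplex is open.                      *)
Definition ref_triangle : set (R * R) :=
  [set z | [/\ 0 < z.1, 0 < z.2 & z.1 + z.2 < 1]].

Definition segment_pt (p q : 'rV[R]_d) (t : R) : 'rV[R]_d := p + t *: (q - p).

Definition triangle_pt (p q r : 'rV[R]_d) (z : R * R) : 'rV[R]_d :=
  p + z.1 *: (q - p) + z.2 *: (r - p).

(* Twice the area of the triangle p q r (square root of a Gram determinant).  *)
Definition parallelogram_area (p q r : 'rV[R]_d) : R :=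
  Num.sqrt (dot (q - p) (q - p) * dot (r - p) (r - p)
            - dot (q - p) (r - p) ^+ 2).

Definition vertices e : seq 'rV[R]_d := [seq vert i | i <- enum e].

(* The integral of f over the part of e in A, for faces that are segments     *)
(* (d = 2) or triangles (d = 3).                                              *)
Definition face_int e (A : set 'rV[R]_d) (f : 'rV[R]_d -> R) : R :=
  match vertices e with
  | [:: p; q] => enorm (q - p) *
      (\int[@lebesgue_measure R]_(t in `]0, 1[ `&` segment_pt p q @^-1` A)
         f (segment_pt p q t))
  | [:: p; q; r] => parallelogram_area p q r *
      (\int[(@lebesgue_measure R \x @lebesgue_measure R)%E]_(z in
           ref_triangle `&` triangle_pt p q r @^-1` A)
         f (triangle_pt p q r z))
  | _ => 0
  end.

Definition face_integrable e (f : 'rV[R]_d -> R) : Prop :=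
  match vertices e with
  | [:: p; q] => (@lebesgue_measure R).-integrable `]0, 1[
      (EFin \o (f \o segment_pt p q))
  | [:: p; q; r] =>
      (@lebesgue_measure R \x @lebesgue_measure R)%E.-integrable ref_triangle
      (EFin \o (f \o triangle_pt p q r))
  | _ => False
  end.

(* V_{h,k}. The values of a representative on the skeleton are arbitrary;     *)
(* membership in L^2(Omega) follows, Omega being bounded.                     *)
Definition dg_space (k : nat) (v : 'rV[R]_d -> R) : Prop :=
  forall T, T \in elements M -> exists p : mpoly.mpoly d R,
    (forall m, mpoly.mcoeff m p != 0 -> (mpoly.mdeg m <= k)%N) /\
    forall x, (hull T)° x -> v x = mpoly.meval (fun i => x 0 i) p.

(* The trace of v from T at a point x of the boundary of T. *)
Definition trace T (v : 'rV[R]_d -> R) (x : 'rV[R]_d) : R :=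
  lim (v @ within (hull T)° (nbhs x)).

(* U T x is the value of the velocity at x in the boundary of T, seen from T. *)
Variable U : cell M -> 'rV[R]_d -> 'rV[R]_d.

Definition Un T e (x : 'rV[R]_d) : R := dot (U T x) (normal T e).

Record admissible_flux : Prop := {
  flux_single_valued : forall e T1 T2 x,
    T1 \in adjacent e -> T2 \in adjacent e -> relint e x ->
    dot (U T1 x) (normal T1 e) = dot (U T2 x) (normal T1 e);
  flux_sign : forall e T, T \in adjacent e ->
    (forall x, relint e x -> 0 <= Un T e x) \/
    (forall x, relint e x -> Un T e x <= 0);
  flux_integrable : forall e T, T \in adjacent e ->
    face_integrable e (Un T e) }.

(* Elements on the two sides of an interior face, and the element of a        *)
(* boundary face. If U.n vanishes on the whole face, the labels + and - are   *)
(* assigned arbitrarily. The default value is never used.                     *)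
Definition Tplus e : cell M :=
  odflt finset.set0 [pick T in adjacent e |
    `[< forall x, relint e x -> Un T e x <= 0 >]].

Definition Tminus e : cell M :=
  odflt finset.set0 [pick T in adjacent e | T != Tplus e].

Definition owner e : cell M := odflt finset.set0 [pick T in adjacent e].

(* Downstream and upstream traces; where U.n = 0 the direction U is tangent   *)
(* to the face and the traces from the two sides are taken instead.           *)
Definition vplus e (v : 'rV[R]_d -> R) (x : 'rV[R]_d) : R :=
  if Un (Tplus e) e x != 0
  then lim (v (x + eps *: U (Tplus e) x) @[eps --> 0^'+])
  else trace (Tplus e) v x.

Definition vminus e (v : 'rV[R]_d -> R) (x : 'rV[R]_d) : R :=
  if Un (Tminus e) e x != 0
  then lim (v (x - eps *: U (Tminus e) x) @[eps --> 0^'+])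
  else trace (Tminus e) v x.

Definition nplus e : 'rV[R]_d := normal (Tplus e) e.
Definition nminus e : 'rV[R]_d := normal (Tminus e) e.

(* {U v}; on a boundary face the average is the one-sided value. *)
Definition flux_average e (v : 'rV[R]_d -> R) (x : 'rV[R]_d) : 'rV[R]_d :=
  if e \in interior_faces
  then 2^-1 *: (vplus e v x *: U (Tplus e) x + vminus e v x *: U (Tminus e) x)
  else trace (owner e) v x *: U (owner e) x.

Definition jump e (v : 'rV[R]_d -> R) (x : 'rV[R]_d) : 'rV[R]_d :=
  if e \in interior_faces
  then vplus e v x *: nplus e + vminus e v x *: nminus e
  else trace (owner e) v x *: normal (owner e) e.

(* The part of the inflow boundary Gamma_- in relint e; empty unless e is a   *)
(* boundary face.                                                             *)
Definition inflow e : set 'rV[R]_d :=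
  [set x | [/\ e \in boundary_faces, relint e x & Un (owner e) e x < 0]].

Definition inflow_union_of_faces : Prop :=
  forall e, e \in boundary_faces ->
    relint e `<=` inflow e \/ relint e `&` inflow e = set0.

Definition inflow_face e : Prop := relint e `<=` inflow e.

(* The part of Gamma_-^o(T) in relint e. *)
Definition inner_inflow T e : set 'rV[R]_d :=
  [set x | [/\ e \in facets T, e \in interior_faces, relint e x
             & Un T e x < 0]].

End Mesh.

(* Bounded polygons and polyhedra: the faces are piecewise flat because       *)
(* closure Omega is a finite union of simplices ([elements_cover]).           *)
Definition bounded_regular_open (R : realType) (d : nat)
    (Omega : set 'rV[R]_d) : Prop :=
  [/\ open Omega, (closure Omega)° = Omega
    & exists r : R, forall x, Omega x -> enorm x <= r].

(* Main.v *)
Require Import Defs.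
From HB Require Import structures.
From mathcomp Require Import all_boot all_order all_algebra.
From mathcomp Require Import all_classical all_reals all_analysis.
From mathcomp Require mpoly.
From mathcomp Require Import measurable_realfun.
From mathcomp Require Import ring lra.

Set Implicit Arguments.
Unset Strict Implicit.
Unset Printing Implicit Defensive.

Import Order.TTheory GRing.Theory Num.Theory.
Import numFieldNormedType.Exports.

Local Open Scope classical_set_scope.
Local Open Scope ring_scope.

(** The sums over elements and their facets are sums over faces and their
    adjacent elements, and the identity holds face by face ([face_by_face]).

    An interior face has exactly two adjacent elements and a boundary face
    exactly one. Near a point of an open facet, membership in an element is
    decided by the sign of the product with the outward normal ([near_facet]),
    because the barycentric coordinates of the facet's vertices are positive
    there and the remaining coordinate is a multiple of that product. Therefore
    two elements on the same side would overlap, two different elements have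
    opposite normals ([opposite_normals]), and a face between two elements is
    interior to their union ([facet_interior]).

    The downstream and upstream traces are the traces from [T+] and [T-]. On
    the open face, if [U.n] is nonzero, the ray along [U] enters [T+] and the
    ray against it enters [T-] ([ray_enters]), where the function is a
    polynomial; all limits are values of these polynomials ([trace_continuous],
    [ray_limit]).

    Consequently every integrand on an interior face is a polynomial times the
    integrable normal flux, which is the same from both sides up to sign, and
    the integrals are linear in the integrands ([face_int_lin]). What remains
    is pointwise algebra: [interior_face_identity] and
    [boundary_face_identity]. *)

(** * The Euclidean product *)

Section Dot.
Variables (R : realType) (d : nat).
Implicit Types u v w : 'rV[R]_d.

Lemma dotC u v : dot u v = dot v u.
Proof. by apply: eq_bigr => i _; rewrite mulrC. Qed.

Lemma dotDl u v w : dot (u + v) w = dot u w + dot v w.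
Proof. by rewrite -big_split; apply: eq_bigr => i _; rewrite mxE mulrDl. Qed.

Lemma dotZl a u v : dot (a *: u) v = a * dot u v.
Proof. by rewrite mulr_sumr; apply: eq_bigr => i _; rewrite mxE mulrA. Qed.

Lemma dotDr u v w : dot w (u + v) = dot w u + dot w v.
Proof. by rewrite dotC dotDl !(dotC w). Qed.

Lemma dotZr a u v : dot u (a *: v) = a * dot u v.
Proof. by rewrite dotC dotZl dotC. Qed.

Lemma dotNl u v : dot (- u) v = - dot u v.
Proof. by rewrite -scaleN1r dotZl mulN1r. Qed.

Lemma dotNr u v : dot v (- u) = - dot v u.
Proof. by rewrite dotC dotNl dotC. Qed.

Lemma dotBr u v w : dot w (u - v) = dot w u - dot w v.
Proof. by rewrite dotDr dotNr. Qed.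

Lemma dot0r u : dot u 0 = 0.
Proof. by rewrite /dot big1 // => i _; rewrite mxE mulr0. Qed.

Lemma dot_sumr (I : finType) (P : pred I) (F : I -> 'rV[R]_d) u :
  dot u (\sum_(i | P i) F i) = \sum_(i | P i) dot u (F i).
Proof.
apply: (big_ind2 (fun x y => dot u x = y)) => //; first exact: dot0r.
by move=> x1 x2 y1 y2 <- <-; rewrite dotDr.
Qed.

Lemma dot_eq0 u : (dot u u == 0) = (u == 0).
Proof.
apply/eqP/eqP => [u0|->]; last exact: dot0r.
apply/rowP => i; rewrite mxE; apply/eqP; rewrite -sqrf_eq0 expr2.
have /psumr_eq0P : forall j, predT j -> 0 <= u 0 j * u 0 j.
  by move=> j _; rewrite -expr2 sqr_ge0.
by move=> /(_ u0) ->.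
Qed.

Lemma dot_ge0 u : 0 <= dot u u.
Proof. by apply: sumr_ge0 => i _; rewrite -expr2 sqr_ge0. Qed.

Lemma dot_gt0 u : u != 0 -> 0 < dot u u.
Proof. by move=> u0; rewrite lt_def dot_eq0 u0 dot_ge0. Qed.

Lemma enorm_eq1 u : enorm u = 1 -> dot u u = 1.
Proof.
by move=> u1; rewrite -(sqr_sqrtr (dot_ge0 u)) -/(enorm u) u1 expr1n.
Qed.

Lemma eq_dotl u v : (forall w, dot u w = dot v w) -> u = v.
Proof.
move=> uv; apply/eqP; rewrite -subr_eq0 -dot_eq0 dotDl dotNl.
by rewrite uv subrr.
Qed.

Lemma continuous_dot u : continuous (dot u : 'rV[R]_d -> R).
Proof.
apply: (continuous_big (@add_continuous R)) => i _ x.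
by apply: continuousM; [exact: cst_continuous|exact: coord_continuous].
Qed.

End Dot.

(** * Barycentric coordinates *)

Section Simplex.
Variables (R : realType) (d : nat) (M : mesh R d).
Implicit Types T : cell M.

(** Affine independence says that the vertices, each with a last coordinate 1
    appended, are the linearly independent rows of a matrix [A]; being [d + 1]
    in number they span, and the coordinates of [x] are those of the row
    [(x, 1)] in this basis. *)
Lemma barycentric_coordinates T : #|T| = d.+1 -> affine_independent T ->
  exists (g : 'I_(nvert M) -> 'rV[R]_d) (k : 'I_(nvert M) -> R), forall x,
    \sum_(i in T) (dot (g i) x + k i) = 1 /\
    x = \sum_(i in T) (dot (g i) x + k i) *: vert i.
Proof.
move=> cT indT.
pose V : 'M[R]_(#|T|, d) := \matrix_(i < #|T|) vert (enum_val i).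
have mulV (v : 'rV_#|T|) : v *m V = \sum_i v 0 i *: vert (enum_val i).
  by rewrite mulmx_sum_row; apply: eq_bigr => i _; rewrite rowK.
pose A : 'M[R]_(#|T|, d + 1) := row_mx V (const_mx 1).
have mul1 (v : 'rV_#|T|) :
    (v *m (const_mx 1 : 'M[R]_(#|T|, 1))) 0 0 = \sum_i v 0 i.
  by rewrite mxE; apply: eq_bigr => i _; rewrite mxE mulr1.
(* [ext v] reads a family [v] over ['I_#|T|] as one over the vertices. *)
pose ext (W : nmodType) (v : 'I_#|T| -> W) k := \sum_(i | enum_val i == k) v i.
have extE (W : nmodType) (v : 'I_#|T| -> W) i : ext W v (enum_val i) = v i.
  by rewrite /ext (eq_bigl (pred1 i)) ?big_pred1_eq // => j /=;
     rewrite (inj_eq enum_val_inj).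
have /eqP rA : row_free A.
  apply: inj_row_free => v; rewrite mul_mx_row -row_mx0 => /eq_row_mx [].
  rewrite mulV => v0 /matrixP/(_ 0 0); rewrite mul1 mxE => v1.
  apply/rowP => i; rewrite mxE -(extE _ (v 0)); apply: indT (enum_valP i).
    by rewrite big_enum_val -[RHS]v1; apply: eq_bigr => j _; rewrite extE.
  by rewrite big_enum_val -[RHS]v0; apply: eq_bigr => j _; rewrite extE.
have /row_fullP [B BA] : row_full A by rewrite /row_full rA cT addn1.
exists (ext _ (fun i => (col i (usubmx B))^T)), (ext _ (dsubmx B 0)) => x.
set v : 'rV_#|T| := row_mx x 1 *m B.
have vE i : dot (col i (usubmx B))^T x + dsubmx B 0 i = v 0 i.
  rewrite /v -[B in RHS]vsubmxK mul_row_col mul1mx [RHS]mxE; congr (_ + _).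
  by rewrite [RHS]mxE; apply: eq_bigr => j _; rewrite !mxE mulrC.
have : v *m A = row_mx x 1 by rewrite -mulmxA BA mulmx1.
rewrite mul_mx_row => /eq_row_mx []; rewrite mulV => vx /matrixP/(_ 0 0).
rewrite mul1 mxE => v1; split.
  by rewrite big_enum_val -[RHS]v1; apply: eq_bigr => i _; rewrite !extE.
by rewrite big_enum_val -[LHS]vx; apply: eq_bigr => i _; rewrite !extE vE.
Qed.

End Simplex.

(** * Points near a facet *)

Lemma cvg_ray (R : realType) (d : nat) (x u : 'rV[R]_d) :
  x + eps *: u @[eps --> 0^'+] --> x.
Proof.
apply: cvg_at_right_filter; rewrite -[X in _ --> X]addr0 -[X in x + X](scale0r u).
apply: cvgD; first exact: cvg_cst.
by apply: cvgZl; exact: cvg_id.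
Qed.

Section Facet.
Variables (R : realType) (d : nat) (M : mesh R d).
Implicit Types (T e s : cell M).

Lemma facet_apex T e : #|T| = d.+1 -> e \in facets T ->
  exists2 j, j \notin e & T = (j |: e)%SET.
Proof.
rewrite inE => cT /andP[eT /eqP ce].
have /cards1P[j Tej] : #|(T :\: e)%SET| == 1%N.
  by rewrite cardsD (finset.setIidPr eT) cT ce subSnn.
exists j; first by have := set11 j; rewrite -Tej inE => /andP[].
by rewrite -Tej finset.setUC -{1}(finset.setID T e) (finset.setIidPr eT).
Qed.

(** An affine function commutes with affine combinations; with
    [k = - dot g v] this covers differences [_ - v]. *)
Lemma dot_affine_combination (g : 'rV[R]_d) (k : R) s (a : 'I_(nvert M) -> R) :
  \sum_(i in s) a i = 1 ->
  dot g (\sum_(i in s) a i *: vert i) + k =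
  \sum_(i in s) a i * (dot g (vert i) + k).
Proof.
move=> a1; rewrite dot_sumr -[k in LHS]mul1r -a1 mulr_suml -big_split.
by apply: eq_bigr => i _; rewrite dotZr mulrDr.
Qed.

(** The coordinate of the vertex [j] opposite to [e] vanishes on [e]: it is a
    height over the facet. *)
Lemma facet_coordinates T e : #|T| = d.+1 -> affine_independent T ->
    e \in facets T ->
  exists j (g : 'I_(nvert M) -> 'rV[R]_d) (k : 'I_(nvert M) -> R),
  let lam i x := dot (g i) x + k i in
  [/\ j \notin e, T = (j |: e)%SET,
      forall x, \sum_(i in T) lam i x = 1,
      forall x, x = \sum_(i in T) lam i x *: vert i &
      forall i l, i \in T -> l \in T -> lam i (vert l) = (i == l)%:R].
Proof.
move=> cT indT eT; have [j je Tj] := facet_apex cT eT.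
have [g [k lamP]] := barycentric_coordinates cT indT.
exists j, g, k; split => // [x|x|i l iT lT]; try by have [] := lamP x.
have [s1 sv] := lamP (vert l).
apply/eqP; rewrite -subr_eq0; apply/eqP; move: i iT.
have delta (W : nmodType) (F : 'I_(nvert M) -> W) :
    \sum_(i in T) F i *+ (i == l) = F l.
  rewrite (bigD1 l) //= eqxx big1 ?addr0 // => i /andP[_ /negPf ->].
  by rewrite mulr0n.
apply: indT.
  rewrite sumrB s1 -[X in _ - X](_ : \sum_(i in T) 1 *+ (i == l) = _).
    by rewrite delta subrr.
  by [].
transitivity (vert l - \sum_(i in T) (vert i : 'rV[R]_d) *+ (i == l)).
  rewrite [X in _ = X - _]sv -sumrB; apply: eq_bigr => i _.
  by rewrite scalerBl scaler_nat.
by rewrite delta subrr.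
Qed.

(** Why a direction orthogonal to a facet is unique up to a factor: such an [n]
    sees only the opposite vertex [j]. *)
Lemma dot_orthogonal_facet e j (lam : 'I_(nvert M) -> R) n (y : 'rV[R]_d) i0 :
  j \notin e -> i0 \in e ->
  (forall i l, i \in e -> l \in e -> dot n (vert i - vert l) = 0) ->
  \sum_(i in (j |: e)%SET) lam i = 1 ->
  y = \sum_(i in (j |: e)%SET) lam i *: vert i ->
  dot n (y - vert i0) = lam j * dot n (vert j - vert i0).
Proof.
move=> je i0e ne lam1 ->; rewrite [LHS]dotBr dot_affine_combination //.
rewrite big_setU1 //= -dotBr [X in _ + X]big1 ?addr0 // => i ie.
by rewrite -dotBr ne // mulr0.
Qed.

Hypothesis d_gt0 : (0 < d)%N.

Lemma facet_vertex T e : e \in facets T -> exists i, i \in e.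
Proof.
rewrite inE => /andP[_ /eqP ce]; apply/set0Pn.
by rewrite -cards_eq0 ce -lt0n.
Qed.

Lemma relint_nonempty T e : e \in facets T -> exists x, relint e x.
Proof.
move=> eT; have [i ie] := facet_vertex eT.
move: eT; rewrite inE => /andP[_ /eqP ce].
exists (\sum_(i in e) d%:R^-1 *: vert i), (fun=> d%:R^-1); split => //.
  by move=> _ _; rewrite invr_gt0 ltr0n.
by rewrite sumr_const ce -[LHS]mulr_natr mulVf // pnatr_eq0 -lt0n.
Qed.

Section OneElement.
Variables (T e : cell M).
Hypotheses (cT : #|T| = d.+1) (indT : affine_independent T).
Hypothesis eT : e \in facets T.

(** Negated and normalised, the gradient of the height over [e] is the outward
    normal. *)
Lemma exists_outward_normal : exists n : 'rV[R]_d, is_outward_normal T e n.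
Proof.
have [j [g [k /= [je Tj _ _ lamE]]]] := facet_coordinates cT indT eT.
have [i0 i0e] := facet_vertex eT.
have jT : j \in T by rewrite Tj setU11.
have sT i : i \in e -> i \in T by move=> ie; rewrite Tj setU1r.
have ji i : i \in e -> (j == i) = false.
  by move=> ie; apply/eqP => ij; rewrite ij ie in je.
have gB i l : i \in T -> l \in T ->
    dot (g j) (vert i - vert l) = (j == i)%:R - (j == l)%:R.
  by move=> iT lT; rewrite -!lamE // dotBr; ring.
have gn0 : g j != 0.
  apply/eqP => g0; have := gB j i0 jT (sT _ i0e).
  by rewrite g0 dotC dot0r eqxx ji // subr0 => /esym/eqP; rewrite oner_eq0.
have g_gt0 := dot_gt0 gn0.
have eg_gt0 : 0 < enorm (g j) by rewrite sqrtr_gt0.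
exists (- (enorm (g j))^-1 *: g j); split.
- rewrite -[RHS]sqrtr1; congr Num.sqrt; rewrite dotZl dotZr.
  have -> : dot (g j) (g j) = enorm (g j) ^+ 2 by rewrite sqr_sqrtr ?dot_ge0.
  by field; exact: lt0r_neq0.
- by move=> i l ie le; rewrite dotZl gB ?sT // !ji // subrr mulr0.
- move=> i l ie; rewrite Tj !inE => /andP[le /orP[/eqP ->|]]; last first.
    by rewrite (negPf le).
  by rewrite dotZl gB ?jT ?sT // eqxx ji // subr0 mulr1 oppr_lt0 invr_gt0.
Qed.

Lemma normalP : is_outward_normal T e (normal T e).
Proof. by apply: xgetPex; exact: exists_outward_normal. Qed.

Lemma dot_normal : dot (normal T e) (normal T e) = 1.
Proof. by have [/enorm_eq1] := normalP. Qed.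

(** Close to a point of the open facet, the coordinates of the facet's
    vertices stay positive, so only the height decides about membership in
    [T], and the height is read off the normal. *)
Lemma near_facet x : relint e x ->
  \forall y \near x, (dot (normal T e) (y - x) < 0 -> (hull T)° y) /\
                     (dot (normal T e) (y - x) <= 0 -> hull T y).
Proof.
move=> ex; have [j [g [k /= [je Tj lam1 lamv lamE]]]] :=
  facet_coordinates cT indT eT.
pose lam i (y : 'rV[R]_d) := dot (g i) y + k i.
have [i0 i0e] := facet_vertex eT; have [_ ne nT] := normalP.
have jT : j \in T by rewrite Tj setU11.
have sT i : i \in e -> i \in T by move=> ie; rewrite Tj setU1r.
have near_pos (A : pred 'I_(nvert M)) z : (forall i, A i -> 0 < lam i z) ->
    \forall y \near z, forall i, A i -> 0 < lam i y.
  move=> z0.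
  refine (@filter_forall _ _ (fun i y => A i -> 0 < lam i y) (nbhs z) _ _) => i.
  case: (boolP (A i)) => Ai; last by near=> y.
  have lamc : continuous (lam i).
    by move=> y; apply: continuousD; [exact: continuous_dot|exact: cst_continuous].
  by near=> y => _; near: y; exact: (cvgr_gt _ (lamc z) _ (z0 _ Ai)).
have lam_hull y : (forall i, i \in T -> 0 <= lam i y) -> hull T y.
  by move=> y0; exists (lam^~ y); split; [|exact: lam1|exact: lamv].
have lam_int y : (forall i, i \in T -> 0 < lam i y) -> (hull T)° y.
  move=> /near_pos y0; rewrite /interior; near=> z.
  by apply: lam_hull => i /(near y0 z _ i)/ltW; apply.
have nh : dot (normal T e) (vert j - vert i0) < 0.
  by apply: nT => //; rewrite inE je.
have height y : dot (normal T e) (y - x) =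
    lam j y * dot (normal T e) (vert j - vert i0).
  case: ex => a [_ a1 xE].
  have -> : dot (normal T e) (y - x) = dot (normal T e) (y - vert i0).
    suff : dot (normal T e) (x - vert i0) = 0 by rewrite !dotBr => ?; lra.
    rewrite xE dotBr dot_affine_combination // big1 // => i ie.
    by rewrite -dotBr ne // mulr0.
  by apply: (dot_orthogonal_facet (lam := lam^~ y) je i0e ne); rewrite -Tj;
    [exact: lam1|exact: lamv].
have pos_e : \forall y \near x, forall i, i \in e -> 0 < lam i y.
  apply: near_pos => i ie; case: ex => a [a0 a1 ->].
  rewrite /lam dot_affine_combination // (bigD1 i) //= lamE ?sT // eqxx mulr1.
  rewrite big1 ?addr0 ?a0 // => l /andP[le li].
  by rewrite lamE ?sT // eq_sym (negPf li) mulr0.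
near=> y; have ye i : i \in e -> 0 < lam i y by move: i; near: y.
split; rewrite height => hy.
  apply: lam_int => i; rewrite Tj !inE => /orP[/eqP ->|/ye //].
  by move: hy; rewrite nmulr_llt0.
apply: lam_hull => i; rewrite Tj !inE => /orP[/eqP ->|/ye/ltW //].
by move: hy; rewrite nmulr_lle0.
Unshelve. all: by end_near. Qed.

Lemma ray_enters x u : relint e x -> dot (normal T e) u < 0 ->
  \forall eps \near 0^'+, (hull T)° (x + eps *: u).
Proof.
move=> ex nu.
have nx : \forall eps \near 0^'+, _ := @cvg_ray _ _ x u _ (near_facet ex).
near=> eps.
have [|+ _] := near nx eps; first by [].
apply; rewrite addrAC subrr add0r dotZr pmulr_rlt0 //.
Unshelve. all: by end_near. Qed.

(** Hence traces are limits along a proper filter: the inward normal leads into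
    the element. *)
Lemma relint_closure_interior x : relint e x -> closure (hull T)° x.
Proof.
move=> ex B Bx.
have nu : dot (normal T e) (- normal T e) < 0 by rewrite dotNr dot_normal ltrN10.
have xn : x + eps *: (- normal T e) @[eps --> (0 : R)^'+] --> x.
  exact: cvg_ray.
have Bn : \forall eps \near 0^'+, B (x + eps *: (- normal T e)) := xn _ Bx.
near (0 : R)^'+ => eps.
exists (x + eps *: (- normal T e)); split; last by near: eps.
by near: eps; exact: ray_enters.
Unshelve. all: by end_near. Qed.

End OneElement.

(** Two different elements on a common facet lie on opposite sides of it: on
    the same side their interiors would meet near the facet. *)
Lemma opposite_normals T1 T2 e :
  #|T1| = d.+1 -> affine_independent T1 ->
  #|T2| = d.+1 -> affine_independent T2 ->
  e \in facets T1 -> e \in facets T2 -> (hull T1)° `&` (hull T2)° = set0 ->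
  normal T2 e = - normal T1 e.
Proof.
move=> cT1 indT1 cT2 indT2 eT1 eT2 disj.
have [j [g [k /= [je Tj lam1 lamv _]]]] := facet_coordinates cT1 indT1 eT1.
have [i0 i0e] := facet_vertex eT1.
have [_ ne1 nT1] := normalP cT1 indT1 eT1.
have [_ ne2 _] := normalP cT2 indT2 eT2.
pose lam i (y : 'rV[R]_d) := dot (g i) y + k i.
have height n y :
    (forall i l, i \in e -> l \in e -> dot n (vert i - vert l) = 0) ->
    dot n (y - vert i0) = lam j y * dot n (vert j - vert i0).
  by move=> ne; apply: (dot_orthogonal_facet (lam := lam^~ y) je i0e ne);
    rewrite -Tj; [exact: lam1|exact: lamv].
have n1j : dot (normal T1 e) (vert j - vert i0) != 0.
  by rewrite lt_eqF // nT1 // Tj !inE eqxx je.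
pose c := dot (normal T2 e) (vert j - vert i0) /
          dot (normal T1 e) (vert j - vert i0).
have n2E : normal T2 e = c *: normal T1 e.
  apply: eq_dotl => y; rewrite dotZl -(addrK (vert i0) y).
  rewrite (height _ _ ne2) (height _ _ ne1).
  by rewrite /c; field.
have c1 : c ^+ 2 = 1.
  have := dot_normal cT2 indT2 eT2.
  by rewrite n2E dotZl dotZr (dot_normal cT1 indT1 eT1) mulr1 expr2.
move/eqP: c1; rewrite sqrf_eq1 => /orP[] /eqP cE; last first.
  by rewrite n2E cE scaleN1r.
have [x xe] := relint_nonempty eT1.
rewrite cE scale1r in n2E.
have nu : dot (normal T1 e) (- normal T1 e) < 0.
  by rewrite dotNr dot_normal // ltrN10.
have ray1 := ray_enters cT1 indT1 eT1 xe nu.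
have ray2 : \forall eps \near 0^'+, (hull T2)° (x + eps *: (- normal T1 e)).
  by apply: (ray_enters cT2 indT2 eT2 xe); rewrite n2E.
near (0 : R)^'+ => eps.
suff : ((hull T1)° `&` (hull T2)°) (x + eps *: (- normal T1 e)) by rewrite disj.
by split; near: eps.
Unshelve. all: by end_near. Qed.

(** On each side of the facet one of the two elements fills a neighbourhood. *)
Lemma facet_interior T1 T2 e x :
  #|T1| = d.+1 -> affine_independent T1 ->
  #|T2| = d.+1 -> affine_independent T2 ->
  e \in facets T1 -> e \in facets T2 -> normal T2 e = - normal T1 e ->
  relint e x -> (hull T1 `|` hull T2)° x.
Proof.
move=> cT1 indT1 cT2 indT2 eT1 eT2 n21 ex.
have H1 := near_facet cT1 indT1 eT1 ex.
have H2 := near_facet cT2 indT2 eT2 ex.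
rewrite /interior; near=> y.
have [|_ y1] := near H1 y; first by [].
have [|_ y2] := near H2 y; first by [].
have [h|h] := leP (dot (normal T1 e) (y - x)) 0; first by left; exact: y1.
by right; apply: y2; rewrite n21 dotNl oppr_le0 ltW.
Unshelve. all: by end_near. Qed.

End Facet.

(** * Polynomial functions *)

Section Polynomials.
Variables (R : realType) (d : nat).

Lemma continuous_meval (p : mpoly.mpoly d R) :
  continuous (fun x : 'rV[R]_d => mpoly.meval (fun i => x 0 i) p).
Proof.
rewrite (_ : (fun x => _) = fun x : 'rV[R]_d => \sum_(m <- mpoly.msupp p)
    mpoly.mcoeff m p * \prod_i x 0 i ^+ mpoly.fun_of_multinom m i); last first.
  by apply/funext => x; rewrite mpoly.mevalE.
apply: (continuous_big (@add_continuous R)) => m _ x.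
apply: continuousM; first exact: cst_continuous.
move: x; apply: (continuous_big (@mul_continuous R)) => i _ x.
apply: (@continuous_comp _ _ _ (fun x : 'rV[R]_d => x 0 i)
  (fun y => y ^+ mpoly.fun_of_multinom m i)); first exact: coord_continuous.
exact: exprn_continuous.
Qed.

Lemma measurable_meval (p : mpoly.mpoly d R) (disp : measure_display)
    (S : measurableType disp) (D : set S) (f : S -> 'rV[R]_d) :
  (forall i, measurable_fun D (fun t => f t 0 i)) ->
  measurable_fun D (fun t => mpoly.meval (fun i => f t 0 i) p).
Proof.
move=> mf; rewrite (_ : (fun t => _) = fun t => \sum_(m <- mpoly.msupp p)
    mpoly.mcoeff m p * \prod_i f t 0 i ^+ mpoly.fun_of_multinom m i); last first.
  by apply/funext => x; rewrite mpoly.mevalE.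
apply: measurable_sum => m; apply: measurable_funM; first exact: measurable_cst.
by apply: measurable_prod => i _; apply: measurable_funX.
Qed.

Lemma continuous_bounded_on (S : topologicalType) (K D : set S) (f : S -> R) :
  compact K -> D `<=` K -> continuous f -> [bounded f x | x in D].
Proof.
move=> cK DK cf.
have /compact_bounded [N [Nr bN]] : compact (f @` K).
  by apply: continuous_compact => //; exact: continuous_subspaceT.
exists N; split => // B NB x Dx; apply: bN NB _ _.
by exists x => //; exact: DK.
Qed.

End Polynomials.

(** * Integrals over faces *)

Section FaceIntegrals.
Variables (R : realType) (d : nat) (M : mesh R d).
Implicit Types (e : cell M) (A B : set 'rV[R]_d) (f g : 'rV[R]_d -> R).

Lemma vertices_enum e s : vertices e = s ->
  exists2 t : seq 'I_(nvert M), s = map (@vert R d M) t &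
  uniq t /\ forall (W : nmodType) (F : 'I_(nvert M) -> W),
    \sum_(i in e) F i = \sum_(i <- t) F i.
Proof.
move=> <-; exists (enum e) => //; split; first exact: enum_uniq.
by move=> W F; rewrite big_enum.
Qed.

Lemma segment_relint e p q t : vertices e = [:: p; q] -> t \in `]0, 1[ ->
  relint e (segment_pt p q t).
Proof.
move=> /vertices_enum[[|i [|j [|? ?]]] //= [-> ->] [/=]].
rewrite inE andbT => ij sumE; rewrite in_itv /= => /andP[t0 t1].
exists (fun k => if k == i then 1 - t else t); split.
- by move=> k _; case: eqP => _; lra.
- by rewrite sumE big_cons big_seq1 eqxx eq_sym (negPf ij); lra.
- rewrite sumE big_cons big_seq1 eqxx eq_sym (negPf ij) /segment_pt.
  by rewrite scalerBl scale1r scalerBr addrA addrAC.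
Qed.

Lemma triangle_relint e p q r z : vertices e = [:: p; q; r] -> ref_triangle z ->
  relint e (triangle_pt p q r z).
Proof.
move=> /vertices_enum[[|i [|j [|k [|? ?]]]] //= [-> -> ->] [/=]].
rewrite !inE negb_or andbT => /andP[/andP[ij ik] jk] sumE [z1 z2 z12].
exists (fun l => if l == i then 1 - z.1 - z.2 else if l == j then z.1 else z.2).
split.
- by move=> l _; case: eqP => _; [lra|case: eqP].
- rewrite sumE !big_cons big_nil eqxx !(eq_sym _ i) (negPf ij) (negPf ik) eqxx.
  by rewrite eq_sym (negPf jk); lra.
- rewrite sumE !big_cons big_nil eqxx !(eq_sym _ i) (negPf ij) (negPf ik) eqxx.
  rewrite eq_sym (negPf jk) /triangle_pt; apply/rowP => l; rewrite !mxE.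
  by ring.
Qed.

(** Only the values on the open face matter, and a domain can be traded for an
    integrand that vanishes off it. *)
Lemma eq_face_int e A B f g :
  (forall x, relint e x -> (f \_ A) x = (g \_ B) x) ->
  face_int e A f = face_int e B g.
Proof.
move=> fg; rewrite /face_int.
case E : (vertices e) => [|p [|q [|r [|? ?]]]] //; congr (_ * _);
  rewrite !Rintegral_mkcondr; apply: eq_Rintegral => z; rewrite inE => zD.
- exact: (fg _ (segment_relint E zD)).
- exact: (fg _ (triangle_relint E zD)).
Qed.

Lemma face_int_set0 e f : face_int e set0 f = 0.
Proof.
by rewrite /face_int; case: (vertices e) => [|p [|q [|r [|? ?]]]] //;
  rewrite preimage_set0 setI0 Rintegral_set0 mulr0.
Qed.

(** The type ascription selects the measurable structure that carries the
    product of Lebesgue measures. *)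
Lemma measurable_ref_triangle :
  measurable (@ref_triangle R : set (measurableTypeR R * measurableTypeR R)).
Proof.
have -> : @ref_triangle R = (fst @^-1` `]0, +oo[) `&` (snd @^-1` `]0, +oo[)
    `&` ((fun z => z.1 + z.2) @^-1` `]-oo, 1[).
  apply/seteqP; split => z /=; rewrite !in_itv /= !andbT.
    by case.
  by case=> -[].
apply: measurableI; first apply: measurableI.
- by rewrite -[X in measurable X]setTI; apply: measurable_fst.
- by rewrite -[X in measurable X]setTI; apply: measurable_snd.
- rewrite -[X in measurable X]setTI.
  by apply: (measurable_funD measurable_fst measurable_snd).
Qed.

Lemma face_integrable_lin e (a b : R) f g :
  face_integrable e f -> face_integrable e g ->
  face_integrable e (fun x => a * f x + b * g x).
Proof.
have lin disp (S : measurableType disp) (mu : measure S R) (D : set S)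
    (u v : S -> R) : measurable D -> mu.-integrable D (EFin \o u) ->
    mu.-integrable D (EFin \o v) ->
    mu.-integrable D (EFin \o (fun t => a * u t + b * v t)).
  move=> mD iu iv.
  rewrite (_ : EFin \o _ = (fun t => (a%:E * (EFin \o u) t)%E) \+
                           (fun t => (b%:E * (EFin \o v) t)%E))%E.
    by apply: integrableD => //; exact: integrableZl.
  by apply/funext => t /=; rewrite EFinD !EFinM.
rewrite /face_integrable; case: (vertices e) => [|p [|q [|r [|? ?]]]] // fi gi.
  exact: (lin _ _ _ _ (f \o _) (g \o _)).
exact: (lin _ _ _ _ (f \o _) (g \o _) measurable_ref_triangle).
Qed.

Lemma face_int_lin e (a b : R) f g :
  face_integrable e f -> face_integrable e g ->
  face_int e setT (fun x => a * f x + b * g x) =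
  a * face_int e setT f + b * face_int e setT g.
Proof.
have lin disp (S : measurableType disp) (mu : measure S R) (D : set S)
    (u v : S -> R) : measurable D -> mu.-integrable D (EFin \o u) ->
    mu.-integrable D (EFin \o v) ->
    \int[mu]_(t in D) (a * u t + b * v t) =
    a * (\int[mu]_(t in D) u t) + b * (\int[mu]_(t in D) v t).
  move=> mD iu iv; rewrite RintegralD ?RintegralZl //.
    rewrite (_ : EFin \o _ = (fun t => (a%:E * (EFin \o u) t)%E)) //.
    exact: integrableZl.
  rewrite (_ : EFin \o _ = (fun t => (b%:E * (EFin \o v) t)%E)) //.
  exact: integrableZl.
rewrite /face_integrable /face_int.
case: (vertices e) => [|p [|q [|r [|? ?]]]]; rewrite ?mulr0 ?addr0 // => fi gi.
  rewrite preimage_setT setIT (lin _ _ _ _ (f \o _) (g \o _)) //.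
  by rewrite mulrDr !(mulrCA (enorm _)).
rewrite preimage_setT setIT.
rewrite (lin _ _ _ _ (f \o _) (g \o _) measurable_ref_triangle) //.
by rewrite mulrDr !(mulrCA (parallelogram_area _ _ _)).
Qed.

(** Polynomials are bounded and measurable on a face, so they can multiply an
    integrable flux. *)
Lemma face_integrable_meval e f (p : mpoly.mpoly d R) : face_integrable e f ->
  face_integrable e (fun x => mpoly.meval (fun i => x 0 i) p * f x).
Proof.
rewrite /face_integrable; case: (vertices e) => [|a [|b [|c [|? ?]]]] // fi.
  apply: (integrableMr _ _ _ fi) => //.
    apply: measurable_meval => i.
    rewrite (_ : (fun t => _) = fun t => a 0 i + t * (b 0 i - a 0 i)); last first.
      by apply/funext => t; rewrite !mxE.
    by apply: measurable_funD => //; apply: measurable_funM.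
  apply: (continuous_bounded_on (@segment_compact _ 0 1)).
    by move=> t /=; rewrite !in_itv /= => /andP[/ltW -> /ltW ->].
  move=> t; apply: (@continuous_comp _ _ _ (segment_pt a b)
    (fun x : 'rV[R]_d => mpoly.meval (fun i => x 0 i) p));
    last exact: continuous_meval.
  apply: continuousD; first exact: cst_continuous.
  by apply: cvgZl; exact: cvg_id.
apply: (integrableMr measurable_ref_triangle _ _ fi).
  apply: measurable_meval => i.
  rewrite (_ : (fun t => _) = fun t => a 0 i + t.1 * (b 0 i - a 0 i)
                                     + t.2 * (c 0 i - a 0 i)); last first.
    by apply/funext => t; rewrite !mxE.
  apply: measurable_funTS.
  apply: measurable_funD; last by apply: measurable_funM.
  by apply: measurable_funD => //; apply: measurable_funM.
apply: (continuous_bounded_on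
  (compact_setX (@segment_compact _ 0 1) (@segment_compact _ 0 1))).
  move=> t [t1 t2 t12]; split; rewrite /= in_itv /=; lra.
move=> t; apply: (@continuous_comp _ _ _ (triangle_pt a b c)
    (fun x : 'rV[R]_d => mpoly.meval (fun i => x 0 i) p));
    last exact: continuous_meval.
apply: continuousD; first apply: continuousD.
- exact: cst_continuous.
- by apply: cvgZl; exact: cvg_fst.
- by apply: cvgZl; exact: cvg_snd.
Qed.

End FaceIntegrals.

(** * Traces on a face *)

Section Traces.
Variables (R : realType) (d : nat) (M : mesh R d).
Hypothesis d_gt0 : (0 < d)%N.
Variables (T e : cell M) (v f : 'rV[R]_d -> R).
Hypotheses (cT : #|T| = d.+1) (indT : affine_independent T).
Hypothesis eT : e \in facets T.
Hypothesis cf : continuous f.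
Hypothesis vf : forall y, (hull T)° y -> v y = f y.

(** Here [f] is the polynomial that represents [v] on [T]. *)
Lemma trace_continuous x : relint e x -> trace T v x = f x.
Proof.
move=> ex; have clx := relint_closure_interior d_gt0 cT indT eT ex.
have FF : ProperFilter (within (hull T)° (nbhs x)) := within_nbhs_proper clx.
have fx : f @ within (hull T)° (nbhs x) --> f x.
  exact: (@cvg_within_filter _ _ f (nbhs x) _ (nbhs (f x)) (hull T)° (@cf x)).
apply: cvg_lim => //; apply: cvg_trans fx.
apply: (@near_eq_cvg _ _ (within (hull T)° (nbhs x)) _ f v).
by apply: (@nearW _ (nbhs x)) => y Ty; rewrite vf.
Qed.

Lemma ray_limit x u : relint e x -> dot (normal T e) u < 0 ->
  lim (v (x + eps *: u) @[eps --> 0^'+]) = f x.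
Proof.
move=> ex nu; apply: cvg_lim => //.
have ray := ray_enters d_gt0 cT indT eT ex nu.
have fx : f (x + eps *: u) @[eps --> (0 : R)^'+] --> f x.
  exact: (cvg_comp _ _ (@cvg_ray _ _ x u) (@cf x)).
apply: cvg_trans fx; apply: near_eq_cvg; near=> eps.
by rewrite vf //; near: eps.
Unshelve. all: by end_near. Qed.

End Traces.

(** * Elements at a face and the balance on it *)

(* The short name also belongs to a notion about sequences. *)
Local Notation adjacent := Defs.adjacent.

Section Assembly.
Variables (R : realType) (d : nat) (Omega : set 'rV[R]_d) (M : mesh R d).
Variable U : cell M -> 'rV[R]_d -> 'rV[R]_d.
Hypothesis d_gt0 : (0 < d)%N.
Hypothesis hOmega : bounded_regular_open Omega.
Hypothesis hM : triangulation M Omega.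
Hypothesis hU : admissible_flux U.
Implicit Types (T e : cell M).

Lemma in_adjacent e T :
  (T \in adjacent e) = (T \in elements M) && (e \in facets T).
Proof. by rewrite inE. Qed.

Lemma adjacent_opposite e T1 T2 : T1 \in adjacent e -> T2 \in adjacent e ->
  T1 != T2 -> normal T2 e = - normal T1 e.
Proof.
rewrite !in_adjacent => /andP[T1M eT1] /andP[T2M eT2] T12.
have [cT1 indT1] := element_simplex hM T1M.
have [cT2 indT2] := element_simplex hM T2M.
by apply: opposite_normals => //; exact: (elements_disjoint hM).
Qed.

Lemma normal_neq_opp e T : T \in adjacent e -> normal T e <> - normal T e.
Proof.
rewrite in_adjacent => /andP[TM eT]; have [cT indT] := element_simplex hM TM.
move=> nN; have := dot_normal d_gt0 cT indT eT.
by rewrite {1}nN dotNl dot_normal // => /eqP; rewrite lt_eqF // ltrN10.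
Qed.

(** Of three elements on a face, two would have the same normal. *)
Lemma adjacent_pair e T1 T2 : T1 \in adjacent e -> T2 \in adjacent e ->
  T1 != T2 -> adjacent e = [set T1; T2]%SET.
Proof.
move=> T1e T2e T12; apply/setP => T; rewrite in_set2.
apply/idP/orP => [Te|[/eqP ->|/eqP ->] //].
have [_|TT1] := eqVneq T T1; first by left.
have [_|TT2] := eqVneq T T2; first by right.
have n2 := adjacent_opposite T1e T2e T12.
rewrite eq_sym in TT1; rewrite eq_sym in TT2.
have n1 := adjacent_opposite T1e Te TT1.
have := adjacent_opposite T2e Te TT2.
by rewrite n1 n2 opprK => /esym/(normal_neq_opp T1e).
Qed.

(** If there were elements on both sides, the open face would be interior to
    their union, hence to the closure of [Omega]; but [Omega] is the interior
    of its closure and does not meet its boundary. *)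
Lemma boundary_face_adjacent e : e \in boundary_faces M Omega ->
  adjacent e = [set owner e]%SET.
Proof.
rewrite inE => /andP[/bigcupP[T TM eT] /asboolP ebd].
have Te : T \in adjacent e by rewrite in_adjacent TM.
have oe : owner e \in adjacent e.
  by rewrite /owner; case: pickP => [//|/(_ T)]; rewrite Te.
apply/setP => T'; rewrite finset.in_set1; apply/idP/eqP => [T'e|-> //].
apply/eqP; apply: contraPT isT => neq _.
have n12 := adjacent_opposite oe T'e; rewrite eq_sym in neq.
have {}n12 := n12 neq.
move: oe T'e; rewrite !in_adjacent => /andP[oM eo] /andP[T'M eT'].
have [co indo] := element_simplex hM oM.
have [cT' indT'] := element_simplex hM T'M.
have [x ex] := relint_nonempty d_gt0 eT.
have [opO clO _] := hOmega.
have [] : boundary Omega x.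
  apply: ebd; case: ex => a [a0 a1 ->]; exists a; split => // i ie.
  exact/ltW/a0.
move=> _; apply; rewrite -clO.
have : (hull (owner e) `|` hull T')° x by apply: facet_interior eo eT' _ ex.
have sub : hull (owner e) `|` hull T' `<=` closure Omega.
  rewrite (elements_cover hM) => y [hy|hy]; first by exists (owner e).
  by exists T'.
move=> /(interiorS sub); rewrite clO; have /interior_id -> := opO.
done.
Qed.

(** Seen from the other side the normal flux changes sign, so one of the two
    elements sees it nonpositive and the choice of [Tplus] succeeds. *)
Lemma interior_face_adjacent e : e \in interior_faces M Omega ->
  [/\ Tplus U e \in adjacent e, Tminus U e \in adjacent e,
      Tminus U e != Tplus U e &
      forall x, relint e x -> Un U (Tplus U e) e x <= 0].
Proof.
rewrite inE => /andP[enb ef]; have /bigcupP[T TM eT] := ef.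
have Te : T \in adjacent e by rewrite in_adjacent TM.
have [T' T'e TT'] : exists2 T', T' \in adjacent e & T' != T.
  have [ebd|[T' T'M [neq eT']]] := faces_match hM TM eT.
    by move: enb; rewrite inE ef /= => /negP[]; apply/asboolP.
  by exists T' => //; rewrite in_adjacent T'M.
have [S Se SU] : exists2 S, S \in adjacent e &
    forall x, relint e x -> Un U S e x <= 0.
  have [U0|U0] := flux_sign hU Te; last by exists T.
  exists T' => // x ex; rewrite /Un.
  rewrite (flux_single_valued hU T'e Te ex).
  rewrite eq_sym in TT'; rewrite (adjacent_opposite Te T'e TT').
  by rewrite dotNr oppr_le0; exact: U0.
have [pe pU] : Tplus U e \in adjacent e /\
    forall x, relint e x -> Un U (Tplus U e) e x <= 0.
  rewrite /Tplus; case: pickP => [S' /andP[? /asboolP ?] //|/(_ S)].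
  by rewrite Se /= => /negP[]; apply/asboolP.
have [me mp] : Tminus U e \in adjacent e /\ Tminus U e != Tplus U e.
  rewrite {1 2}/Tminus; case: pickP => [S' /andP[] //|none].
  have [TE|TE] := eqVneq T (Tplus U e).
    by have := none T'; rewrite T'e -TE TT'.
  by have := none T; rewrite Te TE.
by [].
Qed.

Lemma sum_facets (V : nmodType) (F : cell M -> cell M -> V) :
  \sum_(T in elements M) \sum_(e in facets T) F T e =
  \sum_(e in faces M) \sum_(T in adjacent e) F T e.
Proof.
rewrite (exchange_big_dep (mem (faces M))) /=; last first.
  by move=> T e TM eT; apply/bigcupP; exists T.
by apply: eq_bigr => e _; apply: eq_bigl => T; rewrite in_adjacent.
Qed.

(** The facet terms of all elements are gathered by face; boundary and interior
    faces then balance separately. *)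
Lemma face_by_face (V : zmodType) (F G : cell M -> cell M -> V)
    (B D E : cell M -> V) (P : pred (cell M)) :
  (forall e, e \in boundary_faces M Omega ->
     \sum_(T in adjacent e) F T e - \sum_(T in adjacent e) G T e - B e =
     if P e then D e else 0) ->
  (forall e, e \in interior_faces M Omega -> P e /\
     \sum_(T in adjacent e) F T e - \sum_(T in adjacent e) G T e =
     D e + E e) ->
  \sum_(T in elements M) \sum_(e in facets T) F T e
  - \sum_(T in elements M) \sum_(e in facets T) G T e
  - \sum_(e in boundary_faces M Omega) B e
  = \sum_(e in faces M | P e) D e + \sum_(e in interior_faces M Omega) E e.
Proof.
move=> bd inn.
have face_split (H : cell M -> V) : \sum_(e in faces M) H e =
    \sum_(e in boundary_faces M Omega) H e
    + \sum_(e in interior_faces M Omega) H e.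
  rewrite (big_setID (boundary_faces M Omega)) /= (finset.setIidPr _) //.
  by apply/fintype.subsetP => e; rewrite inE => /andP[].
rewrite !sum_facets -sumrB big_mkcondr /= !face_split addrAC -sumrB.
rewrite -[RHS]addrA -big_split /=; congr (_ + _); apply: eq_bigr => e he.
  exact: bd.
by have [-> ->] := inn e he.
Qed.

Variables (k : nat) (c w : 'rV[R]_d -> R).
Hypotheses (hc : dg_space M k c) (hw : dg_space M k w).

Lemma interior_not_inflow e : e \in interior_faces M Omega ->
  ~ inflow_face Omega U e.
Proof.
rewrite inE => /andP[enb /bigcupP[T TM eT]] einf.
have [x ex] := relint_nonempty d_gt0 eT.
by have [eb _ _] := einf x ex; rewrite eb in enb.
Qed.

(** Where the flux does not vanish the ray enters the element; where it
    vanishes [vplus] is defined as this trace. *)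
Lemma vplus_trace v e x : dg_space M k v -> e \in interior_faces M Omega ->
  relint e x -> vplus U e v x = trace (Tplus U e) v x.
Proof.
move=> hv ei ex; have [pe me mp pU] := interior_face_adjacent ei.
rewrite /vplus; case: ifPn => // Un0.
move: pe; rewrite in_adjacent => /andP[pM ep].
have [cp indp] := element_simplex hM pM; have [q [_ vq]] := hv _ pM.
rewrite (trace_continuous d_gt0 cp indp ep (@continuous_meval _ _ q) vq ex).
apply: (ray_limit d_gt0 cp indp ep (@continuous_meval _ _ q) vq ex).
by rewrite dotC lt_neqAle Un0 pU.
Qed.

Lemma Un_minus e x : e \in interior_faces M Omega -> relint e x ->
  Un U (Tminus U e) e x = - Un U (Tplus U e) e x.
Proof.
move=> ei ex; have [pe me mp pU] := interior_face_adjacent ei.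
rewrite /Un (flux_single_valued hU me pe ex).
by rewrite eq_sym in mp; rewrite (adjacent_opposite pe me mp) dotNr.
Qed.

Lemma vminus_trace v e x : dg_space M k v -> e \in interior_faces M Omega ->
  relint e x -> vminus U e v x = trace (Tminus U e) v x.
Proof.
move=> hv ei ex; have [pe me mp pU] := interior_face_adjacent ei.
rewrite /vminus; case: ifPn => // Un0.
have Um := Un_minus ei ex.
move: me; rewrite in_adjacent => /andP[mM em].
have [cm indm] := element_simplex hM mM; have [q [_ vq]] := hv _ mM.
rewrite (trace_continuous d_gt0 cm indm em (@continuous_meval _ _ q) vq ex).
under eq_fun do rewrite -scalerN.
apply: (ray_limit d_gt0 cm indm em (@continuous_meval _ _ q) vq ex).
rewrite dotNr dotC oppr_lt0 lt_def Un0 /= -/(Un _ _ _ _) Um oppr_ge0.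
exact: pU.
Qed.

(** On an inflow face both terms on the left agree; on any other boundary face
    the inflow part is empty and the average times the jump is the integrand on
    the left. *)
Lemma boundary_face_identity e : inflow_union_of_faces Omega U ->
  e \in boundary_faces M Omega ->
  face_int e setT (fun x => trace (owner e) c x * trace (owner e) w x
                            * Un U (owner e) e x)
  - face_int e (inflow Omega U e)
       (fun x => trace (owner e) c x * Un U (owner e) e x
                 * trace (owner e) w x)
  = if `[< inflow_face Omega U e >] then 0 else
    face_int e setT
       (fun x => dot (flux_average Omega U e c x) (jump Omega U e w x)).
Proof.
move=> hG eb; case: asboolP => [ein|enin].
  apply/eqP; rewrite subr_eq0; apply/eqP; apply: eq_face_int => x /ein xin.
  by rewrite !patchE !mem_set //; ring.
have [//|e0] := hG e eb.
rewrite (eq_face_int (A := inflow Omega U e) (B := set0) (g := fun=> 0));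
  last first.
  move=> x ex; rewrite !patchE !memNset // => xin.
  by suff : (relint e `&` inflow Omega U e) x by rewrite e0.
rewrite face_int_set0 subr0; apply: eq_face_int => x ex.
rewrite !patchE !mem_set // /flux_average /jump.
have -> : (e \in interior_faces M Omega) = false by rewrite inE eb.
by rewrite dotZl dotZr /Un; ring.
Qed.

(** With [a = U.n+ <= 0], the traces from [T+] and [T-] and [n- = - n+], the
    integrands on the left sum to [a (c+ w+ - c- w- - (c+ - c-) w+)], those on
    the right to [a/2 (c+ + c-) (w+ - w-) - a/2 (c+ - c-) (w+ - w-)]; both are
    [a c- (w+ - w-)]. The set of integration in the inflow term may be enlarged
    to the whole face because [a] vanishes on the rest. *)
Lemma interior_face_identity e : e \in interior_faces M Omega ->
  \sum_(T in adjacent e)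
     face_int e setT (fun x => trace T c x * trace T w x * Un U T e x)
  - \sum_(T in adjacent e)
     face_int e (inner_inflow Omega U T e)
       (fun x => (vplus U e c x - vminus U e c x) * vplus U e w x
                 * dot (U (Tplus U e) x) (nplus U e))
  = face_int e setT
       (fun x => dot (flux_average Omega U e c x) (jump Omega U e w x))
  + face_int e setT
       (fun x => `|dot (U (Tplus U e) x) (nplus U e)| / 2
                 * dot (jump Omega U e c x) (jump Omega U e w x)).
Proof.
move=> ei; have [pe me mp pU] := interior_face_adjacent ei.
set P := Tplus U e; set Q := Tminus U e.
have PQ : P != Q by rewrite eq_sym.
have nQ : normal Q e = - normal P e := adjacent_opposite pe me PQ.
rewrite (adjacent_pair pe me PQ) !big_setU1 ?finset.in_set1 //= !big_set1.
have poly v T : dg_space M k v -> T \in adjacent e ->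
    exists q, forall x, relint e x ->
      trace T v x = mpoly.meval (fun i => x 0 i) q.
  move=> hv; rewrite in_adjacent => /andP[TM eT].
  have [cT indT] := element_simplex hM TM; have [q [_ vq]] := hv _ TM.
  exists q => x ex.
  exact: (trace_continuous d_gt0 cT indT eT (@continuous_meval _ _ q) vq ex).
have [cp cpE] := poly c P hc pe; have [cm cmE] := poly c Q hc me.
have [wp wpE] := poly w P hw pe; have [wm wmE] := poly w Q hw me.
pose ev q (x : 'rV[R]_d) : R := mpoly.meval (fun i => x 0 i) q.
pose a x := Un U P e x.
pose F q r x := ev q x * (ev r x * a x).
have Fi q r : face_integrable e (F q r).
  by do 2!apply: face_integrable_meval; exact: (flux_integrable hU pe).
have ext A f g : (forall x, relint e x -> (f \_ A) x = g x) ->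
    face_int e A f = face_int e setT g.
  by move=> fg; apply: eq_face_int => x /fg ->; rewrite patchE mem_set.
have lin := fun s t q r q' r' => face_int_lin s t (Fi q r) (Fi q' r').
have lini := fun s t q r q' r' => face_integrable_lin s t (Fi q r) (Fi q' r').
have nP : dot (normal P e) (normal P e) = 1.
  move: pe; rewrite in_adjacent => /andP[PM eP].
  by have [cP indP] := element_simplex hM PM; exact: dot_normal.
(* All integrands are combinations of the four products of a trace of [c], a
   trace of [w] and the normal flux. *)
have -> : face_int e setT (fun x => trace P c x * trace P w x * Un U P e x) =
    face_int e setT (F cp wp).
  apply: ext => x ex; rewrite patchE mem_set // cpE // wpE //.
  by rewrite /F /ev /a; ring.
have -> : face_int e setT (fun x => trace Q c x * trace Q w x * Un U Q e x) =
    - face_int e setT (F cm wm).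
  rewrite (ext _ _ (fun x => 0 * F cm wm x + -1 * F cm wm x)); last first.
    move=> x ex; rewrite patchE mem_set // cmE // wmE // (Un_minus ei ex).
    by rewrite /F /ev /a; ring.
  by rewrite lin; ring.
have -> : face_int e (inner_inflow Omega U P e)
       (fun x => (vplus U e c x - vminus U e c x) * vplus U e w x
                 * dot (U P x) (nplus U e)) =
    face_int e setT (F cp wp) - face_int e setT (F cm wp).
  rewrite (ext _ _ (fun x => 1 * F cp wp x + -1 * F cm wp x)); last first.
    move=> x ex; rewrite patchE.
    have eP : e \in facets P by move: pe; rewrite in_adjacent => /andP[].
    case: ifPn => [_|]; last first.
      move=> /negP xin; have a0 : a x = 0.
        apply/eqP/negPn/negP => a0; apply: xin; rewrite inE; split => //.
        by rewrite lt_neqAle a0 pU.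
      by transitivity (0 : R) => //; rewrite /F a0; ring.
    rewrite (vplus_trace hc) // (vplus_trace hw) // (vminus_trace hc) //.
    rewrite cpE // cmE // wpE // -/(normal P e) -/(Un U P e x).
    by rewrite /F /ev /a; ring.
  by rewrite lin; ring.
have -> : face_int e (inner_inflow Omega U Q e)
       (fun x => (vplus U e c x - vminus U e c x) * vplus U e w x
                 * dot (U P x) (nplus U e)) = 0.
  rewrite (ext _ _ (fun x => 0 * F cm wm x + 0 * F cm wm x)); last first.
    move=> x ex; rewrite patchE memNset ?mul0r ?addr0 // => -[_ _ _].
    by rewrite (Un_minus ei ex) oppr_lt0 ltNge pU.
  by rewrite lin; ring.
have -> : face_int e setT
       (fun x => dot (flux_average Omega U e c x) (jump Omega U e w x)) =
    2^-1 * (face_int e setT (F cp wp) - face_int e setT (F cp wm))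
    + 2^-1 * (face_int e setT (F cm wp) - face_int e setT (F cm wm)).
  rewrite (ext _ _ (fun x => 2^-1 * (1 * F cp wp x + -1 * F cp wm x)
                           + 2^-1 * (1 * F cm wp x + -1 * F cm wm x))).
    rewrite (face_int_lin _ _ (lini _ _ _ _ _ _) (lini _ _ _ _ _ _)) !lin.
    by ring.
  move=> x ex; rewrite patchE mem_set // /flux_average /jump ei.
  rewrite (vplus_trace hc) // (vplus_trace hw) // (vminus_trace hc) //.
  rewrite (vminus_trace hw) // cpE // cmE // wpE // wmE //.
  have Um : dot (U Q x) (normal P e) = a x := esym (flux_single_valued hU pe me ex).
  have Up : dot (U P x) (normal P e) = a x by [].
  rewrite /nplus /nminus -/P -/Q nQ.
  rewrite !(dotZl, dotZr, dotDl, dotDr, dotNr) Um Up /F /ev.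
  by ring.
have -> : face_int e setT
       (fun x => `|dot (U P x) (nplus U e)| / 2
                 * dot (jump Omega U e c x) (jump Omega U e w x)) =
    (- 2^-1) * (face_int e setT (F cp wp) - face_int e setT (F cp wm))
    + 2^-1 * (face_int e setT (F cm wp) - face_int e setT (F cm wm)).
  rewrite (ext _ _ (fun x => (- 2^-1) * (1 * F cp wp x + -1 * F cp wm x)
                           + 2^-1 * (1 * F cm wp x + -1 * F cm wm x))).
    rewrite (face_int_lin _ _ (lini _ _ _ _ _ _) (lini _ _ _ _ _ _)) !lin.
    by ring.
  move=> x ex; rewrite patchE mem_set // /jump ei.
  rewrite (vplus_trace hc) // (vplus_trace hw) // (vminus_trace hc) //.
  rewrite (vminus_trace hw) // cpE // cmE // wpE // wmE //.
  rewrite /nplus /nminus -/P -/Q nQ ler0_norm; last exact: pU.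
  rewrite !(dotZl, dotZr, dotDl, dotDr, dotNr, dotNl) nP -/(Un U P e x) -/(a x).
  by rewrite /F /ev; ring.
by field.
Qed.

End Assembly.

(** * The identity *)

Theorem lemma4p1 (R : realType) (d : nat) (hd : d = 2%N \/ d = 3%N)
    (Omega : set 'rV[R]_d) (M : mesh R d) (sigma : R)
    (U : cell M -> 'rV[R]_d -> 'rV[R]_d) (kc : nat) (c w : 'rV[R]_d -> R)
    (hOmega : bounded_regular_open Omega)
    (hM : triangulation M Omega)
    (hsigma : shape_regular M sigma)
    (hU : admissible_flux U)
    (hGamma : inflow_union_of_faces Omega U)
    (hc : dg_space M kc c) (hw : dg_space M kc w) :
  \sum_(T in elements M) \sum_(e in facets T)
     face_int e setT (fun x => trace T c x * trace T w x * Un U T e x)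
  - \sum_(T in elements M) \sum_(e in facets T)
     face_int e (inner_inflow Omega U T e)
       (fun x => (vplus U e c x - vminus U e c x) * vplus U e w x
                 * dot (U (Tplus U e) x) (nplus U e))
  - \sum_(e in boundary_faces M Omega)
     face_int e (inflow Omega U e)
       (fun x => trace (owner e) c x * Un U (owner e) e x
                 * trace (owner e) w x)
  = \sum_(e in faces M | ~~ `[< inflow_face Omega U e >])
     face_int e setT
       (fun x => dot (flux_average Omega U e c x) (jump Omega U e w x))
  + \sum_(e in interior_faces M Omega)
     face_int e setT
       (fun x => `|dot (U (Tplus U e) x) (nplus U e)| / 2
                 * dot (jump Omega U e c x) (jump Omega U e w x)).
Proof.
have d_gt0 : (0 < d)%N by case: hd => ->.
apply: face_by_face => e he.
- rewrite (boundary_face_adjacent d_gt0 hOmega hM he) !big_set1 if_neg.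
  rewrite -(boundary_face_identity c w hGamma he) -[RHS]subr0 addrAC.
  congr (_ - _); rewrite -[RHS](face_int_set0 e (fun=> 0)).
  apply: eq_face_int => x _.
  by rewrite !patchE !memNset // => -[_]; rewrite inE he.
- split; last exact: (interior_face_identity d_gt0 hM hU hc hw he).
  by apply/asboolPn; exact: (interior_not_inflow d_gt0 he).
Qed.
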